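(* Let $T$ be an $r$-row non-skew fluctuating tableau of length $n$, let $1\le u\le n$ and $1\le j\le n-1$, and let $v\in[n]$ with $v\equiv u+j\pmod n$. Let $w_0w_1\cdots w_{n-1}$ be the lattice word of $\mathcal P^{u-1}(T)$, and apply to $w_1\cdots w_{n-1}$ any sequence of raising operators (each application nonzero) ending at a highest weight word. Then for each $1\le i\le r-1$, $\overline{\mathbf M}^i(T)_{u,v}$ equals the number of times the operator $e_i$ is applied to the letter in position $j$.
   Context: Let $\mathcal A_r$ be the set of subsets $S\subseteq\{\pm1,\ldots,\pm r\}$ with all elements of the same sign (including $\emptyset$); $\mathbf e_S=\sum_{s\in S}\mathbf e_s$ if $S$ is positive and $\mathbf e_S=-\sum_{s\in S}\mathbf e_{-s}$ if negative ($\mathbf e_1,\ldots,\mathbf e_r$ standard basis of $\mathbb Z^r$). An $r$-row non-skew fluctuating tableau of length $n$ is a sequence $0=\lambda^0,\ldots,\lambda^n$ of weakly decreasing vectors in $\mathbb Z^r$ with $\lambda^k=\lambda^{k-1}+\mathbf e_{S_k}$, $S_k\in\mathcal A_r$; its lattice word is $S_1\cdots S_n$ (0-indexed here). $\mathrm{sort}(\alpha)$ is the weakly decreasing rearrangement. The promotion–evacuation diagram of $T$ is $(\lambda^{i,j})_{0\le i\le n,\,i\le j\le n+i}$ with $\lambda^{0,j}=\lambda^j$, $\lambda^{i,i}=\lambda^0$, $\lambda^{i,n+i}=\lambda^n$, and $\lambda^{i,j}=\mathrm{sort}(\lambda^{i-1,j}+\lambda^{i,j-1}-\lambda^{i-1,j-1})$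 for $1\le i\le n$, $i<j<n+i$ (increasing $i$, then $j$). Promotion is $\mathcal P(T)=(\lambda^{1,1},\ldots,\lambda^{1,n+1})$. Reduced promotion matrices (off-diagonal entries): for $u\ne v$ in $[n]$, let $j'=v$ if $u<v$ and $j'=v+n$ if $u>v$, and define $A,B\in\mathcal A_r$ by $\lambda^{u-1,j'-1}=\lambda^{u,j'-1}+\mathbf e_A$ and $\lambda^{u-1,j'}=\lambda^{u,j'}+\mathbf e_B$. Then $\overline{\mathbf M}^i(T)_{uv}$ ($1\le i\le r-1$) are the unique integers with $\mathbf e_B=\mathbf e_A+\sum_{i=1}^{r-1}\overline{\mathbf M}^i(T)_{uv}(\mathbf e_{i+1}-\mathbf e_i)$. (This is equivalent to the paper's definition as the number of entries containing $i$ in block $(u,v)$ of the promotion matrix.) Raising operators (bracketing rule), $1\le i\le r-1$, on words in $\mathcal A_r$: write ''['' under each letter containing $i$ but not $i+1$, or $-(i+1)$ but not $-i$; write '']'' under each letter containing $i+1$ but not $i$, or $-i$ but not $-(i+1)$; match brackets from the inside out. $e_i$ acts on the letter with the rightmost unmatched '']'' by replacing $i+1$ with $i$, or $-i$ with $-(i+1)$; it gives $0$ if no '']'' is unmatched. A word is highest weight if every $e_i$ gives $0$. *)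

(* Defs.v *)
From mathcomp Require Import all_boot all_order all_algebra.

Set Implicit Arguments.
Unset Strict Implicit.
Unset Printing Implicit Defensive.

Import Order.TTheory GRing.Theory Num.Theory.
Local Open Scope ring_scope.

(* Rows are numbered from 0, so k : 'I_r stands for the row k + 1.  The signed
   index (true, k) is +(k + 1) and (false, k) is -(k + 1). *)
Definition signed_index (r : nat) : finType := (bool * 'I_r)%type.

Definition letter (r : nat) : finType := {set signed_index r}.

(* The alphabet A_r is [set S | same_sign S]; elements of [letter r] outside of
   it never occur in the lattice word of a fluctuating tableau. *)
Definition same_sign (r : nat) (S : letter r) : bool :=
  [forall x in S, forall y in S, x.1 == y.1].

Definition evec (r : nat) (S : letter r) : 'rV[int]_r :=
  \sum_(x in S) (if x.1 then delta_mx 0 x.2 else - delta_mx 0 x.2).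

Definition weakly_decreasing (r : nat) (a : 'rV[int]_r) : Prop :=
  forall k l : 'I_r, (k <= l)%N -> a 0 l <= a 0 k.

(* A tableau of length n is the tuple of its n + 1 vectors. *)
Definition fluctuating_tableau (r n : nat) (T : n.+1.-tuple 'rV[int]_r) : Prop :=
  [/\ T`_0 = 0,
      forall k, (k <= n)%N -> weakly_decreasing T`_k
    & forall k, (k < n)%N ->
        exists2 S : letter r, same_sign S & T`_k.+1 = T`_k + evec S].

(* The letter S of A_r with evec S = d, which is unique when it exists. *)
Definition letter_of (r : nat) (d : 'rV[int]_r) : letter r :=
  odflt set0 [pick S : letter r | same_sign S && (evec S == d)].

Definition lattice_word (r n : nat) (T : n.+1.-tuple 'rV[int]_r) :
    seq (letter r) :=
  [seq letter_of (T`_k.+1 - T`_k) | k <- iota 0 n].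

Definition sort_vec (r : nat) (a : 'rV[int]_r) : 'rV[int]_r :=
  \row_(k < r) (sort (fun x y : int => y <= x) [seq a 0 l | l : 'I_r])`_k.

(* Row i of the diagram, computed from row i - 1 (the function f); only the
   columns i <= j <= n + i are meaningful. *)
Fixpoint next_row (r n : nat) (l0 ln : 'rV[int]_r) (i : nat)
    (f : nat -> 'rV[int]_r) (j : nat) : 'rV[int]_r :=
  if (j <= i)%N then l0
  else if (n + i <= j)%N then ln
  else if j is j'.+1 then sort_vec (f j + next_row n l0 ln i f j' - f j')
  else l0.

Fixpoint pe_diagram (r n : nat) (T : n.+1.-tuple 'rV[int]_r) (i : nat) :
    nat -> 'rV[int]_r :=
  if i is i'.+1 then next_row n T`_0 T`_n i (pe_diagram T i')
  else fun j => T`_j.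

Definition promotion (r n : nat) (T : n.+1.-tuple 'rV[int]_r) :
    n.+1.-tuple 'rV[int]_r :=
  [tuple pe_diagram T 1 k.+1 | k < n.+1].

(* An index i : 'I_r.-1 stands for i + 1 in {1, ..., r - 1}; the rows i + 1 and
   i + 2 are then [row_lo i] and [row_hi i]. *)
Definition row_lo (r : nat) (i : 'I_r.-1) : 'I_r := widen_ord (leq_pred r) i.

Lemma row_hi_proof (r : nat) (i : 'I_r.-1) : (i.+1 < r)%N.
Proof. by rewrite -ltn_predRL. Qed.

Definition row_hi (r : nat) (i : 'I_r.-1) : 'I_r := Ordinal (row_hi_proof i).

(* The family M of the (u, v) entries of the reduced promotion matrices, for u
   and v distinct in {1, ..., n}. *)
Definition reduced_promotion_entries (r n : nat) (T : n.+1.-tuple 'rV[int]_r)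
    (u v : nat) (M : {ffun 'I_r.-1 -> int}) : Prop :=
  let j' := if (u < v)%N then v else (v + n)%N in
  exists A B : letter r,
    [/\ same_sign A /\ same_sign B,
        pe_diagram T u.-1 j'.-1 = pe_diagram T u j'.-1 + evec A,
        pe_diagram T u.-1 j' = pe_diagram T u j' + evec B
      & evec B = evec A +
          \sum_(i < r.-1) M i *: (delta_mx 0 (row_hi i) - delta_mx 0 (row_lo i))].

Definition opening (r : nat) (i : 'I_r.-1) (S : letter r) : bool :=
  ((true, row_lo i) \in S) && ((true, row_hi i) \notin S)
  || ((false, row_hi i) \in S) && ((false, row_lo i) \notin S).

Definition closing (r : nat) (i : 'I_r.-1) (S : letter r) : bool :=
  ((true, row_hi i) \in S) && ((true, row_lo i) \notin S)
  || ((false, row_lo i) \in S) && ((false, row_hi i) \notin S).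

(* Increasing list of the positions of the unmatched closing brackets; [depth]
   opening brackets are pending and the head of [w] is in position [pos]. *)
Fixpoint unmatched_closing (r : nat) (i : 'I_r.-1) (depth pos : nat)
    (w : seq (letter r)) : seq nat :=
  if w is L :: w' then
    if opening i L then unmatched_closing i depth.+1 pos.+1 w'
    else if closing i L then
      if depth is d.+1 then unmatched_closing i d pos.+1 w'
      else pos :: unmatched_closing i 0 pos.+1 w'
    else unmatched_closing i depth pos.+1 w'
  else [::].

Definition raise_pos (r : nat) (i : 'I_r.-1) (w : seq (letter r)) : option nat :=
  ohead (rev (unmatched_closing i 0 0 w)).

Definition raise_letter (r : nat) (i : 'I_r.-1) (S : letter r) : letter r :=
  if (true, row_hi i) \in S then (true, row_lo i) |: S :\ (true, row_hi i)
  else (false, row_hi i) |: S :\ (false, row_lo i).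

(* [None] is the value 0 of the raising operator. *)
Definition raise (r : nat) (i : 'I_r.-1) (w : seq (letter r)) :
    option (seq (letter r)) :=
  omap (fun p => set_nth set0 w p (raise_letter i (nth set0 w p)))
       (raise_pos i w).

Definition highest_weight (r : nat) (w : seq (letter r)) : Prop :=
  forall i : 'I_r.-1, raise i w = None.

(* [raising_sequence w s w'] : successive nonzero applications of raising
   operators lead from w to w'; s lists, in order of application, each operator
   together with the position (from 0) of the letter it acts on. *)
Inductive raising_sequence (r : nat) :
    seq (letter r) -> seq ('I_r.-1 * nat) -> seq (letter r) -> Prop :=
| RaisingNil w : raising_sequence w [::] w
| RaisingCons i p w w1 s w2 :
    raise_pos i w = Some p -> raise i w = Some w1 ->
    raising_sequence w1 s w2 -> raising_sequence w ((i, p) :: s) w2.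

(* Main.v *)
Require Import Defs.
From mathcomp Require Import all_boot all_order all_algebra.
From mathcomp Require Import zify.

Set Implicit Arguments.
Unset Strict Implicit.
Unset Printing Implicit Defensive.

Import Order.TTheory GRing.Theory Num.Theory.
Local Open Scope ring_scope.

(* Replacing T by its promotion of order u - 1, one may assume u = 1.  Write
   lam_q = T_(q+1) and mu_q = P(T)_q, so that mu_(q+1) is the sort of
   mu_q + lam_(q+1) - lam_q, and let N_q(k) be the sum of the first k
   coordinates of lam_q - mu_q.  All these coordinates lie in {s, s + 1} for one
   s in {-1, 0}, so each N_q is a lattice path with steps s and s + 1.  The
   q-th partial sum of any word reached from w_1 ... w_(n-1) by raising operators
   has first k coordinates summing to
   lam_q(1) + ... + lam_q(k) - max (N_q(k), b(k)), for a lattice path b <= N_0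
   with the same steps and end points, b = N_0 at the start:
   raising by e_i cuts off the corner of b at i, and is possible if and only if
   b has a corner there and N_q(i) < b(i) for some q; the letter raised is the one bringing N_q(i) below b(i).  At a highest
   weight word b <= N_q for every q, so the partial sums are the mu_q; that is,
   the word is made of the first n - 1 letters of P(T).  Hence the change of
   weight of the letter in position j, which counts the operators applied to it,
   is (mu_j - mu_(j-1)) - (lam_j - lam_(j-1)) = e_A - e_B. *)

(** * Partial sums of vectors *)

Definition cum (r : nat) (a : 'rV[int]_r) (k : nat) : int :=
  \sum_(l < r | (l < k)%N) a 0 l.

Lemma cumD r (a b : 'rV[int]_r) k : cum (a + b) k = cum a k + cum b k.
Proof. by rewrite /cum -big_split; apply: eq_bigr => l _; rewrite mxE. Qed.

Lemma cumN r (a : 'rV[int]_r) k : cum (- a) k = - cum a k.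
Proof. by rewrite /cum -sumrN; apply: eq_bigr => l _; rewrite mxE. Qed.

Lemma cumB r (a b : 'rV[int]_r) k : cum (a - b) k = cum a k - cum b k.
Proof. by rewrite cumD cumN. Qed.

Lemma cum0v r k : cum (0 : 'rV[int]_r) k = 0.
Proof. by rewrite -(subrr 0) cumB subrr. Qed.

Lemma cum0 r (a : 'rV[int]_r) : cum a 0 = 0.
Proof. by rewrite /cum big_pred0. Qed.

Lemma cumS r (a : 'rV[int]_r) (l : 'I_r) : cum a l.+1 = cum a l + a 0 l.
Proof.
rewrite /cum (bigD1 l) //= addrC; congr (_ + _); apply: eq_bigl => k.
by rewrite -val_eqE /=; lia.
Qed.

Lemma cum_inj r (a b : 'rV[int]_r) :
  (forall k, (k <= r)%N -> cum a k = cum b k) -> a = b.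
Proof.
move=> eq_ab; apply/rowP => l; have := cumS a l.
by rewrite !eq_ab ?(ltnW (ltn_ord l)) ?ltn_ord // cumS => /addrI.
Qed.

Lemma cum_delta r (l : 'I_r) k : cum (delta_mx 0 l) k = (l < k)%N%:R.
Proof.
rewrite /cum; under eq_bigr do rewrite mxE eqxx /=.
rewrite big_mkcond (bigD1 l) //= eqxx big1 => [|j /negPf->]; last by rewrite if_same.
by rewrite addr0; case: ifP.
Qed.

(** In terms of partial sums, adding this root changes one value only, which is why raising is
    followed on paths. *)
Lemma cum_root r (i : 'I_r.-1) k :
  cum (delta_mx 0 (row_lo i) - delta_mx 0 (row_hi i)) k = (k == i.+1)%:R.
Proof. by rewrite cumB !cum_delta /=; lia. Qed.

Lemma rowD r (a b : 'rV[int]_r) l : (a + b) 0 l = a 0 l + b 0 l.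
Proof. by rewrite mxE. Qed.

Lemma rowB r (a b : 'rV[int]_r) l : (a - b) 0 l = a 0 l - b 0 l.
Proof. by rewrite !mxE. Qed.

(** For [s = 0] and [s = -1] these are the vectors of the positive and of the negative letters; a
    free [s] treats both signs at once. *)
Definition two_valued (s : int) (r : nat) (a : 'rV[int]_r) : Prop :=
  forall l, s <= a 0 l <= s + 1.

(** * Letters *)

Lemma evecE r (S : letter r) l :
  evec S 0 l = ((true, l) \in S)%:R - ((false, l) \in S)%:R.
Proof.
rewrite /evec summxE big_mkcond.
pose F b k : int := if (b, k) \in S then
  ((if b then delta_mx 0 k else - delta_mx 0 k) : 'rV[int]_r) 0 l else 0.
transitivity (\sum_b \sum_k F b k).
  by rewrite pair_bigA; apply: eq_bigr => -[b k] _.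
have sumF b : \sum_k F b k = F b l.
  rewrite (bigD1 l) //= big1 ?addr0 // => k /negPf kl.
  by rewrite /F; case: b; case: ifP => // _; rewrite !mxE eq_sym kl.
rewrite big_bool /= !sumF /F !mxE !eqxx /=.
by case: ifP; case: ifP; rewrite ?subrr ?addr0 ?add0r ?subr0 ?sub0r.
Qed.

Lemma same_signP r (S : letter r) k l :
  same_sign S -> (true, k) \in S -> (false, l) \in S -> False.
Proof. by move=> /'forall_in_'forall_in_eqP sS /sS/[apply]. Qed.

Lemma same_sign_intro r (S : letter r) :
  (forall k l, (true, k) \in S -> (false, l) \in S -> False) -> same_sign S.
Proof.
move=> sS; apply/'forall_in_'forall_in_eqP => -[[] k] kS [[] l] lS //=.
  by case: (sS _ _ kS lS).
by case: (sS _ _ lS kS).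
Qed.

Lemma two_valued_evec r (S : letter r) :
  same_sign S -> exists2 s : int, -1 <= s <= 0 & two_valued s (evec S).
Proof.
move=> sS; case: (boolP [exists l, (true, l) \in S]) => [/existsP[k kS]|].
  exists 0 => // l; rewrite evecE.
  case: (boolP ((false, l) \in S)) => [/(same_signP sS kS)//|_].
  by case: (_ \in _).
rewrite negb_exists => /forallP nS; exists (-1) => // l; rewrite evecE.
by rewrite (negPf (nS l)); case: (_ \in _).
Qed.

Lemma evec_of_two_valued r (d : 'rV[int]_r) (s : int) :
  -1 <= s <= 0 -> two_valued s d -> exists2 S, same_sign S & d = evec S.
Proof.
move=> s01 ds; exists [set x | d 0 x.2 == (if x.1 then 1 else -1)].
  apply: same_sign_intro => k l; rewrite !inE /=.
  by have := ds k; have := ds l; lia.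
by apply/rowP => l; rewrite evecE !inE /=; have := ds l; lia.
Qed.

Lemma letter_ofP r (d : 'rV[int]_r) :
  (exists2 S, same_sign S & d = evec S) ->
  same_sign (letter_of d) /\ evec (letter_of d) = d.
Proof.
rewrite /letter_of; case=> S sS dS; case: pickP => [L /andP[sL /eqP]//|/(_ S)].
by rewrite sS dS eqxx.
Qed.

Lemma row_lo_hi r (i : 'I_r.-1) : (row_lo i == row_hi i) = false.
Proof. by rewrite -val_eqE /=; lia. Qed.

Lemma bracket_height r (i : 'I_r.-1) (S : letter r) : same_sign S ->
  evec S 0 (row_lo i) - evec S 0 (row_hi i)
    = (opening i S)%:R - (closing i S)%:R.
Proof.
move=> sS; rewrite !evecE /opening /closing.
have := @same_signP _ _ (row_lo i) (row_lo i) sS.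
have := @same_signP _ _ (row_lo i) (row_hi i) sS.
have := @same_signP _ _ (row_hi i) (row_lo i) sS.
have := @same_signP _ _ (row_hi i) (row_hi i) sS.
by do 4![case: (_ \in S)] => //= *; exfalso; auto.
Qed.

Lemma opening_closing r (i : 'I_r.-1) (S : letter r) : same_sign S ->
  opening i S -> closing i S = false.
Proof.
move=> sS; rewrite /opening /closing.
have := @same_signP _ _ (row_lo i) (row_lo i) sS.
have := @same_signP _ _ (row_hi i) (row_hi i) sS.
by do 4![case: (_ \in S)] => //= *; exfalso; auto.
Qed.

Lemma raise_letterP r (i : 'I_r.-1) (S : letter r) : same_sign S ->
  closing i S ->
  same_sign (raise_letter i S) /\
  evec (raise_letter i S)
    = evec S + (delta_mx 0 (row_lo i) - delta_mx 0 (row_hi i)).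
Proof.
move=> sS; rewrite /closing /raise_letter.
case: (boolP (_ \in S)) => /= [hiS | _].
  have nS l : (false, l) \in S = false.
    by apply/negP; apply: same_signP sS hiS.
  rewrite !nS /= orbF => loS; split.
    by apply: same_sign_intro => k l _; rewrite !inE nS.
  apply/rowP => l; rewrite !mxE !evecE !inE nS !xpair_eqE /=.
  case: eqP => [->|_]; first by rewrite row_lo_hi (negPf loS).
  by case: eqP => [->|_]; rewrite ?hiS //=; case: (_ \in S).
case/andP => loS hiS.
have nS l : (true, l) \in S = false.
  by apply/negP => lS; apply: same_signP sS lS loS.
split; first by apply: same_sign_intro => k l; rewrite !inE nS.
apply/rowP => l; rewrite !mxE !evecE !inE nS !xpair_eqE /=.
case: eqP => [->|_]; first by rewrite eq_sym row_lo_hi (negPf hiS).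
by case: eqP => [->|_]; rewrite ?loS //=; case: (_ \in S).
Qed.

(** * Sorted vectors and the local rule *)

Lemma sort_vec_decreasing r (a : 'rV[int]_r) : weakly_decreasing (sort_vec a).
Proof.
move=> k l le_kl; rewrite !mxE.
set s := sort _ _.
have size_s : size s = r by rewrite size_sort size_map size_enum_ord.
have ge_trans : transitive (fun x y : int => y <= x).
  by move=> x y z xy zx; apply: le_trans zx xy.
have ge_refl : reflexive (fun x y : int => y <= x) by move=> x /=.
have srt : sorted (fun x y : int => y <= x) s.
  by apply: sort_sorted => x y; apply: le_total.
by apply: (sorted_leq_nth ge_trans ge_refl 0 srt) => //; rewrite inE size_s.
Qed.

Lemma sum_sort_vec r (a : 'rV[int]_r) (f : int -> int) :
  \sum_l f (sort_vec a 0 l) = \sum_l f (a 0 l).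
Proof.
under eq_bigr do rewrite mxE.
set s := sort _ _.
have size_s : size s = r by rewrite size_sort size_map size_enum_ord.
transitivity (\sum_(x <- s) f x).
  by rewrite (big_nth 0) size_s big_mkord.
by rewrite (perm_big [seq a 0 l | l : 'I_r]) ?perm_sort // big_image.
Qed.

Lemma sum_gt0_at (I : finType) (i : I) (g : I -> int) :
  (forall l, (l == i)%:R <= g l) -> 0 < \sum_l g l.
Proof.
move=> le_g; apply: lt_le_trans (_ : \sum_l (l == i)%:R <= _); last first.
  exact: ler_sum.
by rewrite (bigD1 i) //= eqxx big1 // => j /negPf->.
Qed.

(** Sorting preserves the number of entries that are at least a given value. If the sorted entry [i]
    were below [b 0 i + t], so would be all later ones, whereas the entries of [a] up to [i] reach
    this value: the counts would differ. A too large entry is excluded in the same way with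
    [b 0 i + t + 2]. *)
Lemma sort_vec_two_valued r (b a : 'rV[int]_r) (t : int) :
  weakly_decreasing b -> two_valued t (a - b) -> two_valued t (sort_vec a - b).
Proof.
move=> decb tab i; have dec := @sort_vec_decreasing r a.
have count_ge (v : int) := sum_sort_vec a (fun x => ((v <= x)%R)%:R).
have tabE l : b 0 l + t <= a 0 l <= b 0 l + t + 1.
  by have := tab l; rewrite rowB; lia.
rewrite rowB; apply/andP; split; rewrite leNgt; apply/negP => lt_i.
  have := count_ge (b 0 i + t) => /esym/eqP; rewrite -subr_eq0 -sumrB.
  apply/negP; rewrite gt_eqF //; apply: (@sum_gt0_at _ i) => l.
  have := tabE l; have := decb l i; have := dec i l.
  by case: eqP => [->|/eqP]; rewrite -?val_eqE /=; case: (leqP l i); lia.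
have := count_ge (b 0 i + t + 2) => /eqP; rewrite -subr_eq0 -sumrB.
apply/negP; rewrite gt_eqF //; apply: (@sum_gt0_at _ i) => l.
have := tabE l; have := tabE i; have := decb i l; have := dec l i.
by case: eqP => [->|/eqP]; rewrite -?val_eqE /=; case: (leqP l i); lia.
Qed.

Lemma cum_sub_const r (a : 'rV[int]_r) (v : int) k :
  cum a k = \sum_(l < r | (l < k)%N) (a 0 l - v) + \sum_(l < r | (l < k)%N) v.
Proof. by rewrite -big_split; apply: eq_bigr => l _ /=; rewrite subrK. Qed.

(* Sorting preserves the total excess over [v], which bounds the excess of the
   first [k] entries, with equality when [v] separates them from the others. *)
Lemma excess_ge r (a : 'rV[int]_r) (v : int) k :
  \sum_(l < r | (l < k)%N) (a 0 l - v) <= \sum_l Num.max (a 0 l - v) 0.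
Proof. by rewrite big_mkcond; apply: ler_sum => l _; case: ifP; lia. Qed.

Lemma excess_eq r (a : 'rV[int]_r) (v : int) k :
  (forall l : 'I_r, (l < k)%N -> v <= a 0 l) ->
  (forall l : 'I_r, (k <= l)%N -> a 0 l <= v) ->
  \sum_(l < r | (l < k)%N) (a 0 l - v) = \sum_l Num.max (a 0 l - v) 0.
Proof.
move=> lo hi; rewrite big_mkcond; apply: eq_bigr => l _.
by have := lo l; have := hi l; case: ltnP; lia.
Qed.

Lemma cum_sort_vec_ge r (a : 'rV[int]_r) k :
  (k <= r)%N -> cum a k <= cum (sort_vec a) k.
Proof.
case: k => [|k] lt_kr; first by rewrite !cum0.
(* This value separates the first [k.+1] sorted entries from the others, so their excess over it is
   the total excess. *)
pose v := sort_vec a 0 (Ordinal lt_kr); rewrite !(cum_sub_const _ v) lerD2r.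
rewrite [leRHS]excess_eq ?(sum_sort_vec a (fun x => Num.max (x - v) 0)).
- exact: excess_ge.
- by move=> l lt_lk; apply: sort_vec_decreasing.
- by move=> l lt_kl; apply: sort_vec_decreasing; apply: ltnW.
Qed.

Lemma cum_sort_vec_split r (a : 'rV[int]_r) (v : int) k :
  (k <= r)%N ->
  (forall l : 'I_r, (l < k)%N -> v <= a 0 l) ->
  (forall l : 'I_r, (k <= l)%N -> a 0 l <= v) ->
  cum (sort_vec a) k = cum a k.
Proof.
move=> le_kr lo hi; apply/eqP; rewrite eq_le cum_sort_vec_ge // andbT.
rewrite !(cum_sub_const _ v) lerD2r [leRHS]excess_eq //.
by rewrite -(sum_sort_vec a (fun x => Num.max (x - v) 0)) excess_ge.
Qed.

Lemma cum_full r (a : 'rV[int]_r) : cum a r = \sum_l a 0 l.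
Proof. by apply: eq_bigl => l; rewrite ltn_ord. Qed.

Lemma cum_sort_vec_full r (a : 'rV[int]_r) : cum (sort_vec a) r = cum a r.
Proof. by rewrite !cum_full; apply: (sum_sort_vec _ id). Qed.

Section LocalRule.
Variables (r : nat) (lam mu lam' : 'rV[int]_r) (s t : int).
Hypotheses (dec_mu : weakly_decreasing mu) (dec_lam' : weakly_decreasing lam').
Hypotheses (ds : two_valued s (lam - mu)) (ct : two_valued t (lam' - lam)).
Let mu' := sort_vec (lam' + mu - lam).

Lemma local_rule_vertical : two_valued s (lam' - mu').
Proof.
(* [mu'] is also the sort of [lam' - (lam - mu)], with [lam'] decreasing *)
have : two_valued (- s - 1) (mu' - lam').
  apply: sort_vec_two_valued => // l.
  by have := ds l; rewrite !(rowB, rowD); lia.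
by move=> h l; have := h l; rewrite !(rowB, rowD); lia.
Qed.

Lemma local_rule_horizontal : two_valued t (mu' - mu).
Proof.
apply: sort_vec_two_valued => // l.
by have := ct l; rewrite !(rowB, rowD); lia.
Qed.

Lemma local_rule_cum_full : cum (lam' - mu') r = cum (lam - mu) r.
Proof.
by rewrite !cumB cum_sort_vec_full cumB cumD; lia.
Qed.

Lemma local_rule_cum k : (k <= r)%N -> cum (lam' - mu') k <= cum (lam - mu) k.
Proof.
move=> le_kr; have := cum_sort_vec_ge (lam' + mu - lam) le_kr.
rewrite !(cumB, cumD) -/mu'; lia.
Qed.

(** If [lam'] dropped after [row_lo i], the value [lam' 0 (row_lo i) - s - 1] would separate the
    entries of [lam' + mu - lam] there, and sorting would preserve their partial sum. *)
Lemma local_rule_flat (i : 'I_r.-1) :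
  cum (lam' - mu') i.+1 < cum (lam - mu) i.+1 ->
  lam' 0 (row_lo i) = lam' 0 (row_hi i).
Proof.
move=> lt_cum; apply/eqP; rewrite eq_le (@dec_lam' (row_lo i) (row_hi i) (leqnSn _)) andbT leNgt.
apply/negP => lt_lam.
have split_i : cum mu' i.+1 = cum (lam' + mu - lam) i.+1.
  apply: (@cum_sort_vec_split _ _ (lam' 0 (row_lo i) - s - 1)) => [|l lt_l|l le_l].
  - exact: ltn_ord (row_lo i).
  - by have := ds l; have := @dec_lam' l (row_lo i) lt_l; rewrite !(rowB, rowD); lia.
  - by have := ds l; have := @dec_lam' (row_hi i) l le_l; rewrite !(rowB, rowD); lia.
by move: lt_cum; rewrite cumB split_i !(cumB, cumD); lia.
Qed.

End LocalRule.

(** * Bracketing *)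

Definition psum (r : nat) (w : seq (letter r)) (q : nat) : 'rV[int]_r :=
  \sum_(S <- take q w) evec S.

(** For letters of one sign, [bracket_height] makes this the number of opening minus closing
    brackets among the first [q] letters. *)
Definition height (r : nat) (i : 'I_r.-1) (w : seq (letter r)) (q : nat) : int :=
  psum w q 0 (row_lo i) - psum w q 0 (row_hi i).

Lemma psum0 r (w : seq (letter r)) : psum w 0 = 0.
Proof. by rewrite /psum take0 big_nil. Qed.

Lemma psum_cons r (S : letter r) w q : psum (S :: w) q.+1 = evec S + psum w q.
Proof. by rewrite /psum /= big_cons. Qed.

Lemma psumS r (w : seq (letter r)) q :
  (q < size w)%N -> psum w q.+1 = psum w q + evec (nth set0 w q).
Proof. by move=> lt_q; rewrite /psum (take_nth set0) // big_rcons. Qed.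

Lemma psum_set_nth r (w : seq (letter r)) p S q : (p < size w)%N ->
  psum (set_nth set0 w p S) q
    = psum w q + (if (p < q)%N then evec S - evec (nth set0 w p) else 0).
Proof.
elim: w p q => // L w IHw [|p] [|q] // lt_p; rewrite ?psum0 ?addr0 //.
  by rewrite /= !psum_cons [RHS]addrC addrA subrK.
by rewrite /= !psum_cons IHw // addrA.
Qed.

Lemma height0 r (i : 'I_r.-1) w : height i w 0 = 0.
Proof. by rewrite /height psum0 !mxE. Qed.

Lemma height_cons r (i : 'I_r.-1) (S : letter r) w q : same_sign S ->
  height i (S :: w) q.+1
    = (opening i S)%:R - (closing i S)%:R + height i w q.
Proof.
by move=> sS; rewrite /height psum_cons -bracket_height // !rowD; lia.
Qed.

(** A closing bracket is unmatched when the height, counted from the [d] pending openings, reaches a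
    new minimum below 0. *)
Lemma unmatched_closing_nil r (i : 'I_r.-1) d pos w : all (@same_sign r) w ->
  (forall q, (q <= size w)%N -> 0 <= d%:Z + height i w q) ->
  unmatched_closing i d pos w = [::].
Proof.
elim: w d pos => //= S w IHw d pos /andP[sS sw] ge0.
have ge0S q : (q <= size w)%N ->
    0 <= d%:Z + ((opening i S)%:R - (closing i S)%:R + height i w q).
  by move=> le_q; have := ge0 q.+1 le_q; rewrite height_cons.
have := ge0S 0 (leq0n _); rewrite height0.
have := @opening_closing _ i _ sS; move: ge0S.
case: (opening i S) => [ge0S /(_ isT) nc _|]; last case: (closing i S).
- by apply: IHw => // q /ge0S; rewrite nc; lia.
- move=> ge0S _; case: d ge0 ge0S => [|d] ge0 ge0S; first lia.
  by move=> _; apply: IHw => // q /ge0S; lia.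
- by move=> ge0S _ _; apply: IHw => // q /ge0S; lia.
Qed.

(** The only new minimum below 0 is -1, first reached with the letter [t]. *)
Lemma unmatched_closing_one r (i : 'I_r.-1) d pos w t :
  all (@same_sign r) w -> (t < size w)%N ->
  (forall q, (q <= t)%N -> 0 <= d%:Z + height i w q) ->
  d%:Z + height i w t.+1 = -1 ->
  (forall q, (q <= size w)%N -> -1 <= d%:Z + height i w q) ->
  unmatched_closing i d pos w = [:: (pos + t)%N].
Proof.
elim: w d pos t => //= S w IHw d pos t /andP[sS sw] lt_t ge0 eqN1 geN1.
have ge0S q : (q < t)%N ->
    0 <= d%:Z + ((opening i S)%:R - (closing i S)%:R + height i w q).
  by move=> lt_q; have := ge0 q.+1 lt_q; rewrite height_cons.
have geN1S q : (q <= size w)%N ->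
    -1 <= d%:Z + ((opening i S)%:R - (closing i S)%:R + height i w q).
  by move=> le_q; have := geN1 q.+1 le_q; rewrite height_cons.
have := @opening_closing _ i _ sS; move: eqN1 ge0S geN1S.
rewrite height_cons //; case: t lt_t ge0 => [|t] lt_t ge0.
  rewrite height0; case: (opening i S) => [eqN1 _ _ /(_ isT) nc|].
    by rewrite nc in eqN1; lia.
  case: (closing i S) => [+ _ +  _|]; last lia.
  case: d ge0 geN1 => [|d] _ _; last lia.
  (* After the unmatched bracket the depth is still 0 while the height is -1, so the lower bound -1
     becomes 0 for the remaining word. *)
  move=> _ ge; rewrite unmatched_closing_nil ?addn0 // => q /ge; lia.
rewrite addnS -addSn; case: (opening i S) => [eqN1 ge0S geN1S /(_ isT) nc|].
  rewrite nc in eqN1 ge0S geN1S.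
  apply: IHw => //; first by move=> q; rewrite -ltnS => /ge0S; lia.
  - by lia.
  - by move=> q /geN1S; lia.
case: (closing i S) => eqN1 ge0S geN1S _.
  case: d eqN1 ge0S geN1S {ge0 geN1} => [|d] eqN1 ge0S geN1S.
    by have := ge0S 0 isT; rewrite height0; lia.
  apply: IHw => //; first by move=> q; rewrite -ltnS => /ge0S; lia.
  - by lia.
  - by move=> q /geN1S; lia.
apply: IHw => //; first by move=> q; rewrite -ltnS => /ge0S; lia.
- by lia.
- by move=> q /geN1S; lia.
Qed.

Lemma unmatched_closingP r (i : 'I_r.-1) d pos w p :
  p \in unmatched_closing i d pos w ->
  exists2 q, p = (pos + q)%N & (q < size w)%N && closing i (nth set0 w q).
Proof.
elim: w d pos => //= S w IHw d pos.
have step d' : p \in unmatched_closing i d' pos.+1 w ->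
    exists2 q, p = (pos + q)%N
      & (q < (size w).+1)%N && closing i (nth set0 (S :: w) q).
  by case/IHw => q -> qw; exists q.+1; rewrite ?addnS.
case: ifP => _; first exact: step.
case: ifP => cl; last exact: step.
case: d => [|d]; last exact: step.
rewrite inE => /orP[/eqP->|]; last exact: step.
by exists 0; rewrite ?addn0.
Qed.

Lemma raise_posP r (i : 'I_r.-1) w p :
  raise_pos i w = Some p -> (p < size w)%N && closing i (nth set0 w p).
Proof.
rewrite /raise_pos => pE.
have : p \in unmatched_closing i 0 0 w.
  by rewrite -mem_rev; case: (rev _) pE => //= ? ? [->]; rewrite inE eqxx.
by case/unmatched_closingP => q ->.
Qed.

Lemma raiseE r (i : 'I_r.-1) w p w1 :
  raise_pos i w = Some p -> raise i w = Some w1 ->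
  w1 = set_nth set0 w p (raise_letter i (nth set0 w p)).
Proof. by rewrite /raise => -> [<-]. Qed.

Lemma raiseP r (i : 'I_r.-1) w p w1 : all (@same_sign r) w ->
  raise_pos i w = Some p -> raise i w = Some w1 ->
  [/\ all (@same_sign r) w1, size w1 = size w &
    forall q, evec (nth set0 w1 q) = evec (nth set0 w q)
      + (if q == p then delta_mx 0 (row_lo i) - delta_mx 0 (row_hi i) else 0)].
Proof.
move=> sw pE w1E; have /andP[lt_p cl] := raise_posP pE.
have sp := all_nthP set0 sw p lt_p; have [sS eS] := raise_letterP sp cl.
rewrite (raiseE pE w1E); split.
- apply/(all_nthP set0) => q; rewrite size_set_nth (maxn_idPr lt_p) => lt_q.
  by rewrite nth_set_nth /=; case: eqP => // _; apply: (all_nthP set0 sw).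
- by rewrite size_set_nth; apply/maxn_idPr.
- by move=> q; rewrite nth_set_nth /=; case: eqP => [->|_]; rewrite ?addr0.
Qed.

Lemma psum_raise r (i : 'I_r.-1) w p w1 q : all (@same_sign r) w ->
  raise_pos i w = Some p -> raise i w = Some w1 ->
  psum w1 q = psum w q
    + (if (p < q)%N then delta_mx 0 (row_lo i) - delta_mx 0 (row_hi i) else 0).
Proof.
move=> sw pE w1E; have /andP[lt_p cl] := raise_posP pE.
have [_ eS] := raise_letterP (all_nthP set0 sw p lt_p) cl.
by rewrite (raiseE pE w1E) psum_set_nth // eS addrAC subrr add0r.
Qed.

Lemma raising_sequenceP r (w : seq (letter r)) s w' :
  raising_sequence w s w' -> all (@same_sign r) w ->
  [/\ all (@same_sign r) w', size w' = size w &
    forall q, evec (nth set0 w' q) = evec (nth set0 w q)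
      + \sum_(i < r.-1) (count_mem (i, q) s)%:Z
          *: (delta_mx 0 (row_lo i) - delta_mx 0 (row_hi i))].
Proof.
elim=> {w s w'} [w sw | i p w w1 s w' pE w1E _ IH sw].
  by split=> // q; rewrite big1 ?addr0 // => i _; rewrite scale0r.
have [sw1 sz1 e1] := raiseP sw pE w1E.
have [sw' -> e'] := IH sw1; split=> // q; rewrite e' e1 -addrA; congr (_ + _).
rewrite [RHS](eq_bigr (fun j => ((i, p) == (j, q))%:R
  *: (delta_mx 0 (row_lo j) - delta_mx 0 (row_hi j)) +
  (count_mem (j, q) s)%:Z *: (delta_mx 0 (row_lo j) - delta_mx 0 (row_hi j)))).
  rewrite big_split /=; congr (_ + _).
  rewrite (bigD1 i) //= big1 => [|j ji]; rewrite xpair_eqE eq_sym.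
    by rewrite eqxx eq_sym addr0; case: eqP; rewrite ?scale1r ?scale0r.
  by rewrite (negPf ji) scale0r.
by move=> j _; rewrite -scalerDl /= PoszD; congr (_ *: _); case: eqP.
Qed.

(** * Raising to highest weight *)

(** Heights become second differences of partial sums, to be compared with the corners of paths. *)
Lemma descentE r (a : 'rV[int]_r) (i : 'I_r.-1) :
  a 0 (row_lo i) - a 0 (row_hi i) = 2 * cum a i.+1 - cum a i - cum a i.+2.
Proof. by have := cumS a (row_lo i); have := cumS a (row_hi i) => /=; lia. Qed.

Lemma row_hi_lt r (i : 'I_r.-1) : (i.+1 < r)%N.
Proof. exact: ltn_ord (row_hi i). Qed.

Definition lattice_path (s : int) (r : nat) (f : nat -> int) : Prop :=
  forall k, (k < r)%N -> s <= f k.+1 - f k <= s + 1.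

Lemma lattice_path_cum s r (a : 'rV[int]_r) :
  two_valued s a -> lattice_path s r (cum a).
Proof.
move=> sa k lt_kr; have := sa (Ordinal lt_kr).
by have /= := cumS a (Ordinal lt_kr); lia.
Qed.

(** Tilt [f] so that its steps become 1 and -1, and take a highest point among those where [f]
    exceeds [g]. A higher neighbour would be reached by the extreme step in its direction, so [f]
    would exceed [g] there too; hence this point is a peak. *)
Lemma lattice_path_corner s r (f g : nat -> int) k :
  lattice_path s r f -> lattice_path s r g -> f 0 = g 0 -> f r = g r ->
  (k <= r)%N -> g k < f k ->
  exists i : 'I_r.-1, g i.+1 < f i.+1 /\ 2 * f i.+1 - f i - f i.+2 = 1.
Proof.
move=> pf pg eq0 eqr le_kr lt_k.
pose P (j : 'I_r.+1) := g j < f j.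
(* the slopes [s + 1] and [s] of [f] become [1] and [-1] *)
pose F (j : 'I_r.+1) : int := 2 * f j - (2 * s + 1) * j%:Z.
have Pk : P (Ordinal (le_kr : (k < r.+1)%N)) by [].
case: (Order.TotalTheory.arg_maxP F Pk) => -[j lt_j] Pj max_j; rewrite /P /= in Pj.
case: j lt_j Pj max_j => [|j] lt_j Pj max_j; first by move: Pj; rewrite eq0 ltxx.
have lt_jr : (j.+1 < r)%N.
  by rewrite ltn_neqAle -ltnS lt_j andbT; apply/eqP => jr; move: Pj; rewrite jr eqr ltxx.
have lt_jr1 : (j < r.-1)%N by lia.
exists (Ordinal lt_jr1); split=> //=.
have := pf j (ltnW lt_jr); have := pg j (ltnW lt_jr).
have := pf j.+1 lt_jr; have := pg j.+1 lt_jr.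
have := max_j (Ordinal (ltnW lt_j)); have := max_j (Ordinal (lt_jr : (j.+2 < r.+1)%N)).
by rewrite /P /F /=; lia.
Qed.

Section Rectification.
Variables (r m : nat) (lam mu : nat -> 'rV[int]_r) (s : int).

Let N q := cum (lam q - mu q).

Hypothesis lam_dec : forall q, (q <= m)%N -> weakly_decreasing (lam q).
Hypothesis mu_dec : forall q, (q <= m)%N -> weakly_decreasing (mu q).
Hypothesis mu0 : mu 0 = 0.
Hypothesis N_path : forall q, (q <= m)%N -> lattice_path s r (N q).
Hypothesis N_full : forall q, (q <= m)%N -> N q r = N 0 r.
Hypothesis N_step : forall q k, (q < m)%N -> (k <= r)%N -> N q.+1 k <= N q k.
Hypothesis flat : forall q (i : 'I_r.-1), (q < m)%N ->
  N q.+1 i.+1 < N q i.+1 -> lam q.+1 0 (row_lo i) = lam q.+1 0 (row_hi i).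

Let N_mono p q k : (p <= q <= m)%N -> (k <= r)%N -> N q k <= N p k.
Proof.
case/andP; elim: q => [|q IHq]; first by case: p.
rewrite leq_eqVlt => /orP[/eqP->//|le_pq] lt_qm le_kr.
by apply: le_trans (IHq _ (ltnW lt_qm) le_kr); rewrite ?N_step.
Qed.

(** For [b = N 0] the maximum is [N 0], which gives the initial word; once [b] is below every [N q]
    the partial sums are the [mu q]. *)
Definition rect_state (y : seq (letter r)) (b : nat -> int) : Prop :=
  [/\ [/\ b 0 = 0, b r = N 0 r, lattice_path s r b
        & forall k, (k <= r)%N -> b k <= N 0 k],
      all (@same_sign r) y, size y = m
    & forall q k, (q <= m)%N -> (k <= r)%N ->
        cum (psum y q) k = cum (lam q) k - Num.max (N q k) (b k)].

Let corner (b : nat -> int) (i : nat) := 2 * b i.+1 - b i - b i.+2 == 1.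

(** Let D be the second difference at [i.+1]. If [N q] is at least [b] there, D of the maximum is at
    most D of [N q], and the height is at least the descent of [mu q]. Otherwise it is at most D of
    [b], hence at most 1, and the height is at least the descent of [lam q] minus D of [b]. *)
Lemma rect_height y b (i : 'I_r.-1) q : rect_state y b -> (q <= m)%N ->
  -1 <= height i y q /\
  (height i y q < 0 -> N q i.+1 < b i.+1 /\ corner b i).
Proof.
case=> -[_ _ b_path _] _ _ yE le_qm; have lt_ir := row_hi_lt i.
rewrite /height descentE !yE //; try lia.
have := lam_dec le_qm (k := row_lo i) (l := row_hi i) (leqnSn _).
have := mu_dec le_qm (k := row_lo i) (l := row_hi i) (leqnSn _).
rewrite -subr_ge0 descentE -[_ <= lam q _ _]subr_ge0 descentE /corner.
have := b_path i (ltnW lt_ir); have := b_path i.+1 lt_ir.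
have := N_path le_qm (ltnW lt_ir); have := N_path le_qm lt_ir.
by rewrite /N !cumB; lia.
Qed.

(** Next to a corner of [b] lying above [N q], the path [N q] cannot exceed [b], so the maximum has
    the same corner. *)
Lemma rect_height_corner y b (i : 'I_r.-1) q : rect_state y b -> (q <= m)%N ->
  lam q 0 (row_lo i) = lam q 0 (row_hi i) -> N q i.+1 < b i.+1 -> corner b i ->
  height i y q = -1.
Proof.
case=> -[_ _ b_path _] _ _ yE le_qm; have lt_ir := row_hi_lt i.
rewrite /height descentE !yE //; try lia.
move/eqP; rewrite -subr_eq0 descentE /corner.
have := b_path i (ltnW lt_ir); have := b_path i.+1 lt_ir.
have := N_path le_qm (ltnW lt_ir); have := N_path le_qm lt_ir.
by rewrite /N !cumB; lia.
Qed.

Lemma rect_raise_none y b (i : 'I_r.-1) : rect_state y b ->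
  (forall q, (q <= m)%N -> corner b i -> b i.+1 <= N q i.+1) ->
  raise_pos i y = None.
Proof.
move=> st ge_b; have [_ ss sz _] := st.
rewrite /raise_pos unmatched_closing_nil // => q; rewrite sz add0r => le_qm.
have [_ neg] := rect_height i st le_qm; rewrite leNgt; apply/negP => /neg[lt_b cb].
by have := ge_b q le_qm cb; lia.
Qed.

(** Take [t.+1] to be the first index whose path is below [b] at [i.+1]; it is not 0 because [b] is
    below [N 0]. The strict drop there makes [lam t.+1] flat by [flat], so the height is exactly -1,
    and it is nonnegative before. *)
Lemma rect_raise_some y b (i : 'I_r.-1) q : rect_state y b ->
  (q <= m)%N -> N q i.+1 < b i.+1 -> corner b i ->
  exists2 t, raise_pos i y = Some t
    & (t < m)%N /\ N t.+1 i.+1 < b i.+1 <= N t i.+1.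
Proof.
move=> st le_qm lt_q cb; have [[_ _ _ b_le] ss sz _] := st.
have lt_ir := row_hi_lt i.
have ex : exists q, (q <= m)%N && (N q i.+1 < b i.+1) by exists q; rewrite le_qm.
case: (ex_minnP ex) => -[|t] /andP[le_tm lt_t] min_t.
  by have := b_le i.+1 (ltnW lt_ir); lia.
have ge_t p : (p <= t)%N -> b i.+1 <= N p i.+1.
  move=> le_pt; rewrite leNgt; apply/negP => lt_p; have := min_t p.
  by rewrite lt_p andbT (leq_trans le_pt (ltnW le_tm)); lia.
exists t; last by rewrite lt_t ge_t.
rewrite /raise_pos (@unmatched_closing_one _ _ _ _ _ t) ?sz //.
- move=> p le_pt; rewrite add0r leNgt; apply/negP.
  case/(rect_height i st (leq_trans le_pt (ltnW le_tm))).2 => lt_p _.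
  by have := ge_t p le_pt; lia.
- rewrite add0r; apply: (rect_height_corner st _ _ lt_t cb) => //.
  by apply: flat => //; apply: lt_le_trans lt_t (ge_t t _).
- by move=> p le_pm; rewrite add0r; have [] := rect_height i st le_pm.
Qed.

(** For [q'] beyond [p] the maximum at [i.+1] is [b], and cutting the corner lowers it by 1 as the
    root requires. Up to [p] it is [N q'] before and after the cut. *)
Lemma rect_raise y b (i : 'I_r.-1) p y1 : rect_state y b ->
  raise_pos i y = Some p -> raise i y = Some y1 ->
  rect_state y1 (fun k => b k - (k == i.+1)%:R).
Proof.
move=> st pE y1E; have [[b0 br b_path b_le] ss sz yE] := st.
have lt_ir := row_hi_lt i.
have [ex|/negP nex] := boolP [exists q : 'I_m.+1, (N q i.+1 < b i.+1) && corner b i];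
  last first.
  rewrite (rect_raise_none st) // in pE => q le_qm cb.
  rewrite leNgt; apply/negP => lt_q; apply: nex; apply/existsP.
  by exists (Ordinal (le_qm : (q < m.+1)%N)); rewrite /= lt_q.
have {ex} [[q lt_q] /= /andP[lt_b cb]] := existsP ex.
have [t tE [lt_tm /andP[lt_t le_t]]] := rect_raise_some st (lt_q : (q <= m)%N) lt_b cb.
move: tE; rewrite pE => -[pt]; rewrite -{t}pt in lt_tm lt_t le_t.
have [ss1 sz1 _] := raiseP ss pE y1E.
split=> //; last 1 first.
- move=> q' k le_qm le_kr; rewrite (psum_raise _ ss pE y1E) cumD yE //.
  case: (ltnP p q') => [lt_pq|le_qp]; rewrite ?cum0v ?cum_root.
    have : (p.+1 <= q' <= m)%N by rewrite lt_pq.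
    by move=> /N_mono/(_ le_kr); case: eqP => [->|]; lia.
  have : (q' <= p <= m)%N by rewrite le_qp ltnW.
  by move=> /N_mono/(_ le_kr); case: eqP => [->|]; lia.
- split; first by rewrite b0.
  + by rewrite br gtn_eqF ?subr0.
  (* The cut exchanges the steps [s + 1] and [s] around index [i.+1]. *)
  + move=> k lt_kr; move: cb; rewrite /corner.
    have := b_path i (ltnW lt_ir); have := b_path i.+1 lt_ir; have := b_path k lt_kr.
    case: (k =P i :> nat) => [->|ki]; first by rewrite eqxx; lia.
    by case: (k =P i.+1) => [->|]; lia.
  + by move=> k /b_le; lia.
- by rewrite sz1.
Qed.

Lemma rect_sequence y b sq y' : raising_sequence y sq y' -> rect_state y b ->
  exists b', rect_state y' b'.
Proof.
move=> seq_y; elim: seq_y b => {y sq y'} [y b st|i p y y1 sq y' pE y1E _ IH b st].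
  by exists b.
exact: IH (rect_raise st pE y1E).
Qed.

(** If [b] exceeded some [N q], it would do so at one of its corners, where an operator still
    applies. *)
Lemma rect_highest y b : rect_state y b -> highest_weight y ->
  forall q, (q <= m)%N -> psum y q = mu q.
Proof.
move=> st hw q le_qm; have [[b0 br b_path _] _ _ yE] := st.
apply: cum_inj => k le_kr; rewrite yE // max_l ?/N ?cumB ?subKr //.
rewrite -cumB -/(N q k) leNgt; apply/negP => lt_k.
have N0 : b 0 = N q 0 by rewrite b0 /N cum0.
have Nr : b r = N q r by rewrite N_full.
have [i [lt_i ci]] := lattice_path_corner b_path (N_path le_qm) N0 Nr le_kr lt_k.
have [t tE _] := rect_raise_some st le_qm lt_i (introT eqP ci).
by have := hw i; rewrite /raise tE.
Qed.

Lemma rect_initial y : all (@same_sign r) y -> size y = m ->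
  (forall q, (q <= m)%N -> psum y q = lam q - lam 0) -> rect_state y (N 0).
Proof.
move=> ss sz yE; split=> //; first by split=> //; rewrite ?/N ?cum0 //; exact: N_path.
move=> q k le_qm le_kr; rewrite yE // cumB max_r; first by rewrite /N mu0 subr0.
exact: N_mono.
Qed.

Lemma rectification y sq y' : all (@same_sign r) y -> size y = m ->
  (forall q, (q <= m)%N -> psum y q = lam q - lam 0) ->
  raising_sequence y sq y' -> highest_weight y' ->
  forall q, (q <= m)%N -> psum y' q = mu q.
Proof.
move=> ss sz yE seq_y hw.
have [b st] := rect_sequence seq_y (rect_initial ss sz yE).
exact: rect_highest st hw.
Qed.

End Rectification.

(** * Promotion *)

Lemma next_row_le r n (l0 ln : 'rV[int]_r) i f j :
  (j <= i)%N -> next_row n l0 ln i f j = l0.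
Proof. by case: j => [|j] //= ->. Qed.

Lemma next_row_ge r n (l0 ln : 'rV[int]_r) i f j :
  (i < j)%N -> (n + i <= j)%N -> next_row n l0 ln i f j = ln.
Proof. by case: j => [|j] //=; rewrite ltnNge => /negPf-> ->. Qed.

Lemma next_row_mid r n (l0 ln : 'rV[int]_r) i f j :
  (i <= j)%N -> (j.+1 < n + i)%N ->
  next_row n l0 ln i f j.+1
    = sort_vec (f j.+1 + next_row n l0 ln i f j - f j).
Proof. by rewrite -ltnS /= ltnNge => /negPf->; rewrite ltnNge => /negPf->. Qed.

Lemma next_row_shift r n (l0 ln : 'rV[int]_r) i f g j :
  (forall k, (i <= k <= n + i)%N -> f k.+1 = g k) -> (j <= n + i.+1)%N ->
  next_row n l0 ln i.+2 f j.+1 = next_row n l0 ln i.+1 g j.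
Proof.
move=> fg; elim: j => [|j IHj] le_j; first by rewrite !next_row_le.
have [le_ji|lt_ij] := leqP j.+1 i.+1; first by rewrite !next_row_le.
have [ge_j|lt_j] := leqP (n + i.+1)%N j.+1; first by rewrite !next_row_ge //; lia.
by rewrite [LHS]next_row_mid ?[RHS]next_row_mid ?IHj ?(fg j) ?(fg j.+1) //; lia.
Qed.

Section Promotion.
Variables (r m : nat).
Implicit Type T : m.+2.-tuple 'rV[int]_r.

Lemma nth_promotion T k :
  (k <= m.+1)%N -> (promotion T)`_k = pe_diagram T 1 k.+1.
Proof.
rewrite -ltnS => lt_k.
exact: (nth_mktuple (fun k : 'I_m.+2 => pe_diagram T 1 k.+1) 0 (Ordinal lt_k)).
Qed.

Lemma promotion_first T : (promotion T)`_0 = T`_0.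
Proof. by rewrite nth_promotion //; apply: next_row_le. Qed.

Lemma promotion_last T : (promotion T)`_m.+1 = T`_m.+1.
Proof. by rewrite nth_promotion //; apply: next_row_ge; rewrite ?addn1. Qed.

Lemma promotion_mid T k : (k < m)%N ->
  (promotion T)`_k.+1 = sort_vec (T`_k.+2 + (promotion T)`_k - T`_k.+1).
Proof.
by move=> lt_k; rewrite !nth_promotion; try lia; apply: next_row_mid; lia.
Qed.

(** Deleting the top row of the diagram leaves that of the promotion; this reduces row [u] to the
    first row. *)
Lemma pe_diagram_shift T i j : (i <= j <= m.+1 + i)%N ->
  pe_diagram T i.+1 j.+1 = pe_diagram (promotion T) i j.
Proof.
elim: i j => [|i IHi] j le_j; first by rewrite -nth_promotion //; lia.
rewrite [LHS]/= [RHS]/= promotion_first promotion_last.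
by apply: next_row_shift; [exact: IHi | lia].
Qed.

Lemma pe_diagram_iter T i k : (k <= m.+1)%N ->
  pe_diagram T i (i + k) = (iter i (@promotion r m.+1) T)`_k.
Proof.
move=> le_k; elim: i T => [|i IHi] T //.
by rewrite iterSr -IHi addSn pe_diagram_shift //; lia.
Qed.

Lemma fluctuating_step T k : fluctuating_tableau T -> (k <= m)%N ->
  exists2 t : int, -1 <= t <= 0 & two_valued t (T`_k.+1 - T`_k).
Proof.
case=> _ _ /(_ k); rewrite ltnS => /[apply] -[S sS ->].
by rewrite addrAC subrr add0r; apply: two_valued_evec.
Qed.

Lemma promotion_column T : fluctuating_tableau T ->
  exists2 s : int, -1 <= s <= 0 & forall q, (q <= m)%N ->
    weakly_decreasing (promotion T)`_q /\
    two_valued s (T`_q.+1 - (promotion T)`_q).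
Proof.
move=> fT; have [T0 Tdec _] := fT.
(* Column 0 is the difference of the first two vectors of [T], so the first letter fixes [s] for all
   columns. *)
have [s s01 s2] := fluctuating_step fT (leq0n m).
exists s => //; elim=> [|q IHq] lt_qm.
  by split; rewrite promotion_first //; apply: Tdec.
have [dec ds] := IHq (ltnW lt_qm).
have [t _ t2] := fluctuating_step fT lt_qm.
rewrite promotion_mid //; split; first exact: sort_vec_decreasing.
by apply: local_rule_vertical => //; apply: Tdec.
Qed.

Lemma promotion_fluctuating T :
  fluctuating_tableau T -> fluctuating_tableau (promotion T).
Proof.
move=> fT; have [T0 Tdec _] := fT; have [s s01 col] := promotion_column fT.
split; first by rewrite promotion_first.
- move=> k; rewrite leq_eqVlt => /orP[/eqP->|lt_k]; last by case: (col k).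
  by rewrite promotion_last; apply: Tdec.
- move=> k; rewrite ltnS => le_k.
  have [t t01 t2] : exists2 t : int, -1 <= t <= 0 &
      two_valued t ((promotion T)`_k.+1 - (promotion T)`_k).
    move: le_k; rewrite leq_eqVlt => /orP[/eqP->|lt_k].
      (* The last step of the promotion is the column difference at [m]. *)
      by exists s => //; rewrite promotion_last; case: (col m).
    have [t t01 t2] := fluctuating_step fT lt_k; exists t => //.
    rewrite promotion_mid //; apply: local_rule_horizontal => //.
    by case: (col k (ltnW lt_k)).
  have [S sS eS] := evec_of_two_valued t01 t2.
  by exists S; rewrite // -eS addrC subrK.
Qed.

Lemma iter_promotion_fluctuating T i : fluctuating_tableau T ->
  fluctuating_tableau (iter i (@promotion r m.+1) T).
Proof. by move=> fT; elim: i => //= i; apply: promotion_fluctuating. Qed.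

Lemma behead_lattice_word T : fluctuating_tableau T ->
  let x := behead (lattice_word T) in
  [/\ all (@same_sign r) x, size x = m,
      forall q, (q < m)%N -> evec (nth set0 x q) = T`_q.+2 - T`_q.+1
    & forall q, (q <= m)%N -> psum x q = T`_q.+1 - T`_1].
Proof.
case=> T0 Tdec Tstep x.
have sz : size x = m by rewrite size_behead size_map size_iota.
have nthE q : (q < m)%N -> nth set0 x q = letter_of (T`_q.+2 - T`_q.+1).
  by move=> lt_q; rewrite nth_behead (nth_map 0) ?size_iota // nth_iota.
have letterE q : (q < m)%N ->
    same_sign (nth set0 x q) /\ evec (nth set0 x q) = T`_q.+2 - T`_q.+1.
  move=> lt_q; rewrite nthE //; apply: letter_ofP.
  have [S sS eS] := Tstep q.+1 lt_q.
  by exists S => //; rewrite eS addrAC subrr add0r.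
split=> //; first by apply/(all_nthP set0) => q; rewrite sz => /letterE[].
  by move=> q /letterE[].
elim=> [|q IHq] lt_q; first by rewrite psum0 subrr.
rewrite psumS ?sz // IHq ?(ltnW lt_q) // (letterE q lt_q).2.
by rewrite addrC addrA subrK.
Qed.

Lemma rectification_promotion T sq w' q : fluctuating_tableau T ->
  raising_sequence (behead (lattice_word T)) sq w' -> highest_weight w' ->
  (q <= m)%N -> psum w' q = (promotion T)`_q.
Proof.
move=> fT seq_w hw; have [T0 Tdec _] := fT; have [s s01 col] := promotion_column fT.
have [sx szx _ psx] := behead_lattice_word fT.
have cumN p k : (p < m)%N -> (k <= r)%N ->
    cum (T`_p.+2 - (promotion T)`_p.+1) k <= cum (T`_p.+1 - (promotion T)`_p) k.
  by move=> lt_p le_kr; rewrite promotion_mid //; apply: local_rule_cum.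
apply: (@rectification r m (fun q => T`_q.+1) (fun q => (promotion T)`_q) s
  _ _ _ _ _ cumN _ _ _ _ sx szx psx seq_w hw).
- by move=> p le_p; apply: Tdec.
- by move=> p /col[].
- by rewrite promotion_first.
- by move=> p /col[_ ds]; apply: lattice_path_cum.
- elim=> // p IHp lt_p; rewrite -(IHp (ltnW lt_p)) promotion_mid //.
  exact: local_rule_cum_full.
- move=> p i lt_p; rewrite promotion_mid //; apply: (local_rule_flat (s := s)).
  + exact: Tdec.
  + by case: (col p (ltnW lt_p)).
Qed.

End Promotion.

(** * Entries of the reduced promotion matrices *)

Lemma cum_roots r (M : 'I_r.-1 -> int) (i : 'I_r.-1) :
  cum (\sum_(l < r.-1) M l *: (delta_mx 0 (row_hi l) - delta_mx 0 (row_lo l))) i.+1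
    = - M i.
Proof.
rewrite (big_morph (fun a : 'rV[int]_r => cum a i.+1) (fun a b => cumD a b _) (cum0v r _)).
have cumZ (c : int) (a : 'rV[int]_r) k : cum (c *: a) k = c * cum a k.
  by rewrite /cum mulr_sumr; apply: eq_bigr => l _; rewrite mxE.
rewrite (bigD1 i) //= big1 => [|l /negPf li].
  by rewrite cumZ -opprB cumN cum_root eqxx mulrN1 addr0.
by rewrite cumZ -opprB cumN cum_root eqSS eq_sym val_eqE li oppr0 mulr0.
Qed.

(* Position j of w_0 ... w_(n-1) is position j - 1 of w_1 ... w_(n-1). *)
Theorem theorem8p24 (r n : nat) (T : n.+1.-tuple 'rV[int]_r) (u j v : nat)
    (s : seq ('I_r.-1 * nat)) (w' : seq (letter r)) :
  fluctuating_tableau T ->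
  (1 <= u <= n)%N -> (1 <= j <= n.-1)%N ->
  (1 <= v <= n)%N -> v = (u + j)%N %[mod n] ->
  let w := lattice_word (iter u.-1 (@promotion r n) T) in
  raising_sequence (behead w) s w' -> highest_weight w' ->
  exists2 M : {ffun 'I_r.-1 -> int},
    unique (reduced_promotion_entries T u v) M
    & forall i : 'I_r.-1, M i = Posz (count_mem (i, j.-1) s).
Proof.
case: n T => [|m] T; first by case: u.
case: u => [|u]; case: j => [|q] //= fT lt_u lt_q le_v eq_v seq_w hw.
have colE : (if (u.+1 < v)%N then v else (v + m.+1)%N) = (u + q.+2)%N.
  have /dvdnP[c cE] : (m.+1 %| (u.+1 + q.+1 + m.+1) - v)%N.
    by rewrite -eqn_mod_dvd ?modnDr ?eq_v //; lia.
  (* [c] is 1 when [v] does not wrap around, so that it exceeds the row index, and 2 when it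
     does. *)
  have c12 : c = 1%N \/ c = 2 by case: c cE => [|[|[|c]]]; [lia|auto|auto|nia].
  by case: ifP; case: c12 cE => -> cE; lia.
have fT' := iter_promotion_fluctuating u fT.
set T' := iter u _ T in fT' seq_w.
have [sx szx evx _] := behead_lattice_word fT'.
have [s0 s01 col] := promotion_column fT'.
have [_ dA] := col q (ltnW lt_q); have [_ dB] := col q.+1 lt_q.
have [A sA AE] := evec_of_two_valued s01 dA.
have [B sB BE] := evec_of_two_valued s01 dB.
have eqA : pe_diagram T u (u + q.+2).-1 = T'`_q.+1.
  by rewrite addnS -pred_Sn pe_diagram_iter //; lia.
have eqA' : pe_diagram T u.+1 (u + q.+2).-1 = (promotion T')`_q.
  by rewrite addnS -pred_Sn -addSnnS pe_diagram_iter //; lia.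
have eqB : pe_diagram T u (u + q.+2) = T'`_q.+2 by rewrite pe_diagram_iter.
have eqB' : pe_diagram T u.+1 (u + q.+2) = (promotion T')`_q.+1.
  by rewrite -addSnnS pe_diagram_iter //; lia.
have [sw' szw' evw'] := raising_sequenceP seq_w sx.
have evE : evec (nth set0 w' q) = (promotion T')`_q.+1 - (promotion T')`_q.
  rewrite -!(rectification_promotion fT' seq_w hw) ?(ltnW lt_q) //.
  by rewrite psumS ?szw' ?szx // addrAC subrr add0r.
pose M := [ffun i => (count_mem (i, q) s)%:Z] : {ffun 'I_r.-1 -> int}.
exists M; last by move=> i; rewrite ffunE.
have sumM : \sum_(i < r.-1) M i *: (delta_mx 0 (row_hi i) - delta_mx 0 (row_lo i))
    = evec B - evec A.
  (* The weight lost by the letter in position [q] is computed from the operators applied and from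
     the initial and final words. *)
  transitivity (evec (nth set0 (behead (lattice_word T')) q) - evec (nth set0 w' q)).
    rewrite evw' opprD addrA subrr add0r -sumrN; apply: eq_bigr => i _.
    by rewrite ffunE -scalerN opprB.
  by rewrite evE evx // -AE -BE; apply/rowP => l; rewrite !rowB; lia.
rewrite /reduced_promotion_entries colE; cbv zeta.
rewrite -pred_Sn eqA eqA' eqB eqB'; split.
  by exists A, B; split; rewrite ?sumM -?AE -?BE ?subrKC.
(* The diagram determines the vectors of [A'] and [B'], and the partial sum at [i.+1] of their
   difference recovers [M' i]. *)
move=> M' [A' [B' [_ A'E B'E M'E]]].
apply/ffunP => i; apply: oppr_inj; rewrite -!cum_roots sumM -AE -BE A'E B'E.
by rewrite !(addrC (promotion T')`_ _) !addrK M'E addrC addKr.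
Qed.
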